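(* Let $\mathbf{T}$ be an infinite HPD Toeplitz matrix and let $\mathbf{B}=(b_{k,n})_{k,n=0}^{\infty}$ be the transition matrix associated with $\mathbf{T}$. Assume that the matrix $\mathbf{A}=\overline{\mathbf{B}}\mathbf{B}^{t}=(a_{i,j})_{i,j=0}^{\infty}$ exists. Then: (1) $\mathbf{B}$ is a weakly asymptotic Toeplitz matrix, i.e. for every $k\in\mathbb{N}_0$ the limit $\lim_{n\to\infty} b_{n-k,n}=\beta_k$ exists. (2) $a_{i,k}=\sum_{j=0}^{i}\beta_j\,\overline{\beta_{k-i+j}}$ for all $i,k\in\mathbb{N}_0$ with $i\le k$. (3) If $\sum_{k=0}^{\infty}|\beta_k|^2<\infty$, then $\mathbf{A}$ is a weakly asymptotic Toeplitz matrix and for every $j\in\mathbb{N}_0$ $$\lim_{k\to\infty}a_{k,k+j}=\sum_{i=0}^{\infty}\beta_i\,\overline{\beta_{i+j}},$$ where the series is absolutely convergent.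
   Context: An infinite complex matrix $\mathbf{M}=(c_{i,j})_{i,j=0}^\infty$ is HPD (Hermitian positive definite) if $c_{i,j}=\overline{c_{j,i}}$ for all $i,j$ and $\det\mathbf{M}_n>0$ for all $n\ge0$, where $\mathbf{M}_n=(c_{i,j})_{i,j=0}^n$. It defines an inner product on $\mathbb{C}[z]$ by $\langle z^i,z^j\rangle=c_{i,j}$ (linear in the first variable). The orthonormal polynomials $P_n(z)=\sum_{k=0}^n b_{k,n}z^k$ are those with $\deg P_n=n$, $b_{n,n}>0$ and $\langle P_n,P_m\rangle=\delta_{n,m}$; the transition matrix associated with $\mathbf{M}$ is the upper triangular matrix $\mathbf{B}=(b_{k,n})_{k,n=0}^\infty$, with $b_{k,n}=0$ for $k>n$. $\overline{\mathbf{B}}$ is the entrywise conjugate and $\mathbf{B}^t$ the transpose. The matrix $\mathbf{A}=\overline{\mathbf{B}}\mathbf{B}^t$ is said to exist if the formal product is well defined, with entries $a_{i,j}=\sum_{k=\max\{i,j\}}^{\infty}\overline{b_{i,k}}\,b_{j,k}$ (equivalently, all rows of $\mathbf{B}$ belong to $\ell_2$). A matrix is Toeplitz if its $(i,j)$ entry depends only on $j-i$. An infinite matrix $(a_{i,j})_{i,j=0}^\infty$ is weakly asymptotic Toeplitz if for every $k\in\mathbb{Z}$ the limit $\lim_{n\to\infty}a_{n,n+k}$ exists. $\mathbb{N}_0=\{0,1,2,\dots\}$. *)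

(* Defs.v *)
(* MathComp / MathComp-Analysis. The complex numbers are [R[i]] with [R] an
   arbitrary [realType]; the alias [R[i]^o] is the same type, on which
   MathComp-Analysis finds the topology of the modulus. *)
From HB Require Import structures.
From mathcomp Require Import all_boot all_order all_algebra.
From mathcomp Require Import complex.
From mathcomp Require Import all_classical all_reals all_analysis.

Set Implicit Arguments.
Unset Strict Implicit.
Unset Printing Implicit Defensive.

Import Order.TTheory GRing.Theory Num.Theory.
Import numFieldNormedType.Exports.

Local Open Scope classical_set_scope.
Local Open Scope ring_scope.
Local Open Scope complex_scope.

Definition infmx (R : realType) : Type := nat -> nat -> R[i]^o.

(* The matrix M_n, of order n + 1. *)
Definition section_mx (R : realType) (M : infmx R) (n : nat) : 'M[R[i]]_n.+1 :=
  \matrix_(i < n.+1, j < n.+1) M i j.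

(* In [R[i]], [0 < z] says that z is real and positive. *)
Definition HPD (R : realType) (M : infmx R) : Prop :=
  (forall i j : nat, M i j = Num.conj (M j i)) /\
  (forall n : nat, 0 < \det (section_mx M n)).

Definition toeplitz (R : realType) (M : infmx R) : Prop :=
  exists t : int -> R[i], forall i j : nat, M i j = t (j%:Z - i%:Z).

Definition inner (R : realType) (M : infmx R) (p q : {poly R[i]}) : R[i] :=
  \sum_(i < size p) \sum_(j < size q) p`_i * Num.conj q`_j * M i j.

Definition orthonormal_polys (R : realType) (M : infmx R)
    (P : nat -> {poly R[i]}) : Prop :=
  [/\ forall n : nat, size (P n) = n.+1,
      forall n : nat, 0 < (P n)`_n
    & forall n m : nat, inner M (P n) (P m) = (n == m)%:R].

Definition transition_matrix (R : realType) (M B : infmx R) : Prop :=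
  exists2 P : nat -> {poly R[i]}, orthonormal_polys M P
    & forall k n : nat, B k n = (P n)`_k.

Definition conj_infmx (R : realType) (M : infmx R) : infmx R :=
  fun i j => Num.conj (M i j).

Definition tr_infmx (R : realType) (M : infmx R) : infmx R :=
  fun i j => M j i.

(* The formal product of M and N exists and is equal to P. For M = conj B and
   N = B^t with B upper triangular, the terms with k < max i j vanish. *)
Definition formal_product (R : realType) (M N P : infmx R) : Prop :=
  forall i j : nat,
    series (fun k : nat => (M i k * N k j : R[i]^o)) @ \oo --> P i j.

(* The column index is n + k as soon as n + k >= 0, hence for all large n; the
   absolute value only gives a meaning to the finitely many other indices. *)
Definition weakly_asymptotic_toeplitz (R : realType) (M : infmx R) : Prop :=
  forall k : int, cvgn (fun n : nat => M n (absz (n%:Z + k))).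

(* Main.v *)
Require Import Defs.
From HB Require Import structures.
From mathcomp Require Import all_boot all_order all_algebra.
From mathcomp Require Import complex.
From mathcomp Require Import all_classical all_reals all_analysis.
From mathcomp Require Import ring zify.

Set Implicit Arguments.
Unset Strict Implicit.
Unset Printing Implicit Defensive.

Import Order.TTheory GRing.Theory Num.Theory.
Import numFieldNormedType.Exports.

Local Open Scope classical_set_scope.
Local Open Scope ring_scope.
Local Open Scope complex_scope.

(** Fix N and write P* for the reversed polynomial
    P*(z) = z^N conj(P_N(1 / conj z)), with coefficients conj (b_{N-i,N}).
    Because T is Toeplitz, multiplication by z preserves the inner product, and
    P* is a unit vector orthogonal to z, ..., z^N.  Hence
    z P_0, ..., z P_{N-1}, P* is orthonormal, just like P_0, ..., P_N, in the
    space of polynomials of degree at most N.  Two orthonormal bases of one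
    space have the same reproducing kernel ([dual_gram_kernel]: the matrix of
    the kernel is the inverse of the Gram matrix), and comparing coefficients
    gives an exact, finite form of the Christoffel-Darboux identity
    ([kernel_recursion]): with s^N_{i,j} the sum over k < N of
    conj (b_{i,k}) b_{j,k},

      s^{N+1}_{i,j} = s^N_{i-1,j-1} + b_{N-i,N} conj (b_{N-j,N}),

    where the first term is absent on the border i = 0 or j = 0.

    The existence of A says that s^N_{i,j} tends to a_{i,j}.  So the products
    b_{N-i,N} conj (b_{N-j,N}) converge to the defect a_{i,j} - a_{i-1,j-1}
    ([cvg_toeplitz_defect]).  For i = j = 0 these are the squares of the positive
    numbers b_{N,N}, bounded below by b_{0,0}; hence b_{N,N} converges to a
    nonzero limit ([transition_diag_cvg]).  Dividing the case j = 0 by it gives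
    beta_i, which is (1).  The defect is then beta_i conj (beta_j), and summing it
    along a diagonal gives (2).  For (3), formula (2) exhibits a_{k,k+j} as a
    partial sum of the series of beta_i conj (beta_{i+j}), which is dominated by
    the summable |beta_i|^2 + |beta_{i+j}|^2. *)

(** * Orthonormal polynomials of a Toeplitz form *)

(** Both products are the inverse of G.  When G is a Gram matrix, the rows of X an
    orthonormal basis and X' the conjugate transpose of X, the entries of X' X are
    the coefficients of the reproducing kernel. *)
Lemma dual_gram_kernel (F : comUnitRingType) (n : nat) (G X X' Y Y' : 'M[F]_n) :
  X *m G *m X' = 1%:M -> Y *m G *m Y' = 1%:M -> X' *m X = Y' *m Y.
Proof.
rewrite -mulmxA => /mulmx1C XG; rewrite -mulmxA => /mulmx1C.
move=> /(congr1 (mulmx (X' *m X))).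
have {XG} : X' *m X *m G = 1%:M by apply: mulmx1C; rewrite mulmxA.
by move=> XG; rewrite mulmx1 => <-; rewrite -(mulmxA G) mulmxA XG mul1mx.
Qed.

(** The index i runs upwards: P_i is b_{i,i} z^i plus monomials already known to
    be orthogonal to P_N, and b_{i,i} is nonzero. *)
Lemma orthonormal_ortho_monomial (C : numClosedFieldType) (t : int -> C)
    (b : nat -> nat -> C) (N : nat) :
  (forall k n, (n < k)%N -> b k n = 0) -> (forall n, 0 < b n n) ->
  (forall m, (m < N)%N -> \sum_(i < N.+1) \sum_(j < N.+1)
      b i m * Num.conj (b j N) * t (j%:Z - i%:Z) = 0) ->
  forall i, (i < N)%N ->
    \sum_(j < N.+1) Num.conj (b j N) * t (j%:Z - i%:Z) = 0.
Proof.
move=> bup bpos ort; elim/ltn_ind => m IH ltmN.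
have := ort m ltmN.
have lt_mN1 : (m < N.+1)%N by apply: ltnW.
rewrite (bigD1 (Ordinal lt_mN1)) //= [X in _ + X]big1 ?addr0 => [|i /eqP neq_im].
  under eq_bigr do rewrite -mulrA.
  by rewrite -mulr_sumr => /eqP; rewrite mulf_eq0 gt_eqF ?bpos //= => /eqP.
under eq_bigr do rewrite -mulrA.
rewrite -mulr_sumr; case: (ltngtP i m) => [lt_im|lt_mi|eq_im].
- by rewrite IH ?mulr0 // (ltn_trans lt_im).
- by rewrite bup ?mul0r.
- by case: neq_im; apply: val_inj.
Qed.

(** Both sides are entries of the inverse of the Gram matrix of order N + 1: on
    the left from the basis P_0, ..., P_N, on the right from the basis
    z P_0, ..., z P_{N-1}, P*, where P* is P_N reversed in degree N. *)
Lemma kernel_recursion (C : numClosedFieldType) (t : int -> C)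
    (b : nat -> nat -> C) :
  (forall k, t (- k) = Num.conj (t k)) ->
  (forall k n, (n < k)%N -> b k n = 0) -> (forall n, 0 < b n n) ->
  (forall N m n, (m <= N)%N -> (n <= N)%N -> \sum_(i < N.+1) \sum_(j < N.+1)
      b i m * Num.conj (b j n) * t (j%:Z - i%:Z) = (m == n)%:R) ->
  forall N i j, (i <= N)%N -> (j <= N)%N ->
    \sum_(k < N.+1) Num.conj (b i k) * b j k =
    (if (i == 0)%N || (j == 0)%N then 0
     else \sum_(k < N) Num.conj (b i.-1 k) * b j.-1 k)
    + b (N - i)%N N * Num.conj (b (N - j)%N N).
Proof.
move=> therm bup bpos bort N i j le_iN le_jN.
(* The coefficient of z^i in the k-th vector of the second basis. *)
pose y (k i : nat) : C := if (k == N)%N then Num.conj (b (N - i)%N N)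
                  else if i is i'.+1 then b i' k else 0.
have mom0 := orthonormal_ortho_monomial bup bpos
  (fun m ltmN => etrans (bort N m N (ltnW ltmN) (leqnn N))
                        (congr1 (fun x : bool => x%:R) (ltn_eqF ltmN))).
(* The moments of the reversed polynomial are those of P_N read backwards. *)
have rmom s : (s <= N)%N ->
    \sum_(j < N.+1) b (N - j)%N N * t (j%:Z - s%:Z) =
    Num.conj (\sum_(j < N.+1) Num.conj (b j N) * t (j%:Z - (N - s)%N%:Z)).
  move=> le_sN; rewrite (reindex_inj rev_ord_inj) rmorph_sum.
  apply: eq_bigr => k _; rewrite rmorphM /= conjCK -therm subSS.
  have le_kN : (k <= N)%N by rewrite -ltnS.
  by congr (_ * t _); [rewrite subKn|lia].
(* P* is orthogonal to z^s for 0 < s <= N, but not to 1. *)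
have yrow s : (0 < s)%N -> (s <= N)%N ->
    \sum_(j < N.+1) Num.conj (y N j) * t (j%:Z - s%:Z) = 0.
  move=> s_gt0 le_sN; rewrite /y eqxx.
  under eq_bigr do rewrite conjCK.
  by rewrite rmom // mom0 ?rmorph0 //; lia.
have form_conj p q : \sum_(i < N.+1) \sum_(j < N.+1)
    y p i * Num.conj (y q j) * t (j%:Z - i%:Z) =
  Num.conj (\sum_(i < N.+1) \sum_(j < N.+1)
    y q i * Num.conj (y p j) * t (j%:Z - i%:Z)).
  rewrite exchange_big rmorph_sum; apply: eq_bigr => k _.
  rewrite rmorph_sum; apply: eq_bigr => l _.
  by rewrite !rmorphM /= conjCK -therm opprB [y p l * _]mulrC.
have yN0 k : (k < N)%N -> \sum_(i < N.+1) \sum_(j < N.+1)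
    y k i * Num.conj (y N j) * t (j%:Z - i%:Z) = 0.
  move=> lt_kN; apply: big1 => s _.
  under eq_bigr do rewrite -mulrA.
  rewrite -mulr_sumr; have [s_gt0|] := ltnP 0 s.
    by rewrite yrow ?mulr0 // -ltnS.
  by rewrite leqn0 => /eqP ->; rewrite /y ltn_eqF // mul0r.
have yort p q : (p <= N)%N -> (q <= N)%N -> \sum_(i < N.+1) \sum_(j < N.+1)
    y p i * Num.conj (y q j) * t (j%:Z - i%:Z) = (p == q)%:R.
  rewrite leq_eqVlt => /predU1P[->|lt_pN]; last first.
    rewrite leq_eqVlt => /predU1P[->|lt_qN]; first by rewrite yN0 // ltn_eqF.
    (* Multiplication by z is isometric because the matrix is Toeplitz. *)
    rewrite big_ord_recl /= [X in X + _]big1 => [|k _].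
      rewrite add0r -(bort N.-1); try lia.
      have -> : N.-1.+1 = N by lia.
      apply: eq_bigr => k _; rewrite big_ord_recl {2}/y ltn_eqF //=.
      rewrite rmorph0 mulr0 mul0r add0r; apply: eq_bigr => l _.
      rewrite /y !ltn_eqF //=; congr (_ * t _); rewrite /bump /=; lia.
    by rewrite /y ltn_eqF // !mul0r.
  rewrite leq_eqVlt => /predU1P[->|lt_qN]; last first.
    by rewrite form_conj yN0 // rmorph0 gtn_eqF.
  (* Reversal maps the Toeplitz form to its transpose. *)
  rewrite -(bort N N N) // [RHS]exchange_big (reindex_inj rev_ord_inj).
  apply: eq_bigr => k _; rewrite (reindex_inj rev_ord_inj); apply: eq_bigr => l _.
  rewrite /y eqxx conjCK /= [Num.conj _ * _]mulrC !subSS.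
  have [le_kN le_lN] : (k <= N)%N /\ (l <= N)%N by split; rewrite -ltnS.
  by rewrite !subKn //; congr (_ * t _); lia.
pose G := \matrix_(i < N.+1, j < N.+1) t (j%:Z - i%:Z).
pose coef (x : nat -> nat -> C) := \matrix_(k < N.+1, i < N.+1) x k i.
pose coefa (x : nat -> nat -> C) := \matrix_(i < N.+1, k < N.+1) Num.conj (x k i).
have gram (x : nat -> nat -> C) : (forall p q, (p <= N)%N -> (q <= N)%N ->
    \sum_(i < N.+1) \sum_(j < N.+1)
      x p i * Num.conj (x q j) * t (j%:Z - i%:Z) = (p == q)%:R) ->
    coef x *m G *m coefa x = 1%:M.
  move=> xort; apply/matrixP => p q.
  have [le_pN le_qN] : (p <= N)%N /\ (q <= N)%N by split; rewrite -ltnS.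
  rewrite !mxE -[RHS](xort p q) //.
  rewrite exchange_big; apply: eq_bigr => l _; rewrite !mxE mulr_suml.
  by apply: eq_bigr => k _; rewrite !mxE mulrAC.
have lt_iN : (i < N.+1)%N by [].
have lt_jN : (j < N.+1)%N by [].
have := dual_gram_kernel (gram (fun k i => b i k) (bort N)) (gram y yort).
move=> /matrixP/(_ (Ordinal lt_iN) (Ordinal lt_jN)); rewrite !mxE.
under eq_bigr do rewrite !mxE /=.
move=> ->; rewrite big_ord_recr /= !mxE /= /y eqxx conjCK; congr (_ + _).
under eq_bigr => k _ do rewrite !mxE /= /y ltn_eqF //.
case: i j {le_iN le_jN lt_iN lt_jN} => [|i] [|j] //=.
- by rewrite big1 // => k _; rewrite mulr0.
- by rewrite big1 // => k _; rewrite rmorph0 mul0r.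
- by rewrite big1 // => k _; rewrite mulr0.
Qed.

(** * Sequences and series of complex numbers *)

Lemma cvg_conj (R : realType) (u : nat -> R[i]^o) (l : R[i]^o) :
  u n @[n --> \oo] --> l ->
  (Num.conj (u n) : R[i]^o) @[n --> \oo] --> (Num.conj l : R[i]^o).
Proof.
move=> /cvgrPdist_le ul; apply/cvgrPdist_le => e /ul.
by apply: filterS => n; rewrite -rmorphB norm_conjC.
Qed.

Lemma cvg_Re (R : realType) (u : nat -> R[i]^o) (l : R[i]^o) :
  u n @[n --> \oo] --> l ->
  complex.Re (u n) @[n --> \oo] --> complex.Re l.
Proof.
move=> /cvgrPdist_le ul; apply/cvgrPdist_le => e e_gt0.
have /ul : 0 < (e%:C : R[i]^o) by rewrite ltcE /= eqxx.
apply: filterS => n le_e; rewrite -lecR; apply: le_trans le_e.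
by rewrite -raddfB; exact: normc_ge_Re.
Qed.

Lemma cvg_complex (R : realType) (x y : nat -> R) (a b : R) :
  x n @[n --> \oo] --> a -> y n @[n --> \oo] --> b ->
  (x n +i* y n : R[i]^o) @[n --> \oo] --> (a +i* b : R[i]^o).
Proof.
move=> /cvgrPdist_le xa /cvgrPdist_le yb; apply/cvgrPdist_le => e e_gt0.
have [r r_gt0 ->] : exists2 r : R, 0 < r & e = r%:C + r%:C.
  case: e e_gt0 => er ei; rewrite ltcE /= => /andP[/eqP -> er_gt0].
  by exists (er / 2); rewrite ?divr_gt0 // -(rmorphD (real_complex R)) -splitr.
apply: filterS2 (xa _ r_gt0) (yb _ r_gt0) => n ler_x ler_y.
have -> : (a +i* b : R[i]) - (x n +i* y n) = (a - x n)%:C + 'i%C * (b - y n)%:C.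
  by rewrite [LHS]complexE.
apply: le_trans (ler_normD _ _) _; rewrite lerD //.
  by rewrite normc_def /= expr0n addr0 sqrtr_sqr lecR.
rewrite normrM [`|'i%C|]normc_def /= expr0n expr1n add0r sqrtr1 mul1r.
by rewrite normc_def /= expr0n addr0 sqrtr_sqr lecR.
Qed.

(** Completeness of the reals suffices: the real and the imaginary part of the
    series converge absolutely by comparison with v. *)
Lemma cvg_series_dominated (R : realType) (u : nat -> R[i]^o) (v : nat -> R) :
  (forall n, `|u n| <= ((v n)%:C : R[i])) -> cvgn (series v) ->
  cvgn (series u).
Proof.
move=> le_uv cv.
have v_ge0 n : 0 <= v n by rewrite -ler0c (le_trans _ (le_uv n)).
have real_dominated (x : nat -> R) : (forall n, `|x n| <= v n) -> cvgn (series x).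
  move=> le_xv; apply: (@normed_cvg R R^o).
  exact: (series_le_cvg _ v_ge0 le_xv cv).
have cRe : cvgn (series (fun n => complex.Re (u n))).
  apply: real_dominated => n; rewrite -lecR.
  exact: le_trans (normc_ge_Re (u n)) (le_uv n).
have cIm : cvgn (series (fun n => complex.Im (u n))).
  apply: real_dominated => n; rewrite -lecR; apply: le_trans (le_uv n).
  rewrite -normrN -ReiNIm (le_trans (normc_ge_Re _)) // normrM.
  by rewrite [`|'i%C|]normc_def /= expr0n expr1n add0r sqrtr1 mulr1.
apply/cvg_ex; eexists.
rewrite (_ : series u = fun n => (series (fun n => complex.Re (u n)) n
    +i* series (fun n => complex.Im (u n)) n)).
  exact: (cvg_complex cRe cIm).
apply/funext => n; rewrite /series /=.
have /= <- := raddf_sum (@complex.Re R : {additive R[i] -> R}).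
have /= <- := raddf_sum (@complex.Im R).
by case: (\sum_(_ <= _ < _) _).
Qed.

(** A square root r of a with nonnegative real part satisfies |r + u n| >= c, so
    that |r - u n| <= |a - u n ^+ 2| / c. *)
Lemma cvg_sqrt_pos (R : realType) (u : nat -> R[i]^o) (c : R[i]) (a : R[i]^o) :
  0 < c -> (forall n, c <= u n) ->
  (u n ^+ 2 : R[i]^o) @[n --> \oo] --> a ->
  exists2 r : R[i]^o, r != 0 & u n @[n --> \oo] --> r.
Proof.
move=> c_gt0 le_cu /cvgrPdist_le ua.
have [r r2 r_ge0] : exists2 r : R[i], r ^+ 2 = a & 0 <= 'Re r.
  have /orP[ge0|le0] : (0 <= 'Re (sqrtC a)) || ('Re (sqrtC a) <= 0).
  - by rewrite -realE Creal_Re.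
  - by exists (sqrtC a); rewrite ?sqrtCK.
  - by exists (- sqrtC a); rewrite ?sqrrN ?sqrtCK // raddfN oppr_ge0.
have u_real n : u n \is Num.real by rewrite ger0_real // (le_trans (ltW c_gt0)).
have le_c n : c <= `|r + u n|.
  apply: le_trans (_ : `|'Re (r + u n)| <= _); last exact: (leif_normC_Re_Creal _).1.
  rewrite raddfD /= (Creal_ReP _ (u_real n)) ger0_norm.
    by rewrite (le_trans (le_cu n)) // lerDr.
  by rewrite addr_ge0 // (le_trans (ltW c_gt0)).
have ur : u n @[n --> \oo] --> (r : R[i]^o).
  apply/cvgrPdist_le => e e_gt0.
  apply: filterS (ua (e * c) (mulr_gt0 e_gt0 c_gt0)) => n.
  rewrite -r2 subr_sqr normrM => le_ec; rewrite -(ler_pM2r c_gt0).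
  by apply: le_trans le_ec; rewrite ler_wpM2l.
exists r => //; apply/negP => /eqP r0; move/cvgrPdist_lt: ur => /(_ c c_gt0).
case=> n _ /(_ n (leqnn n)) /=; rewrite r0 sub0r normrN ger0_norm.
  by move=> /(le_lt_trans (le_cu n)); rewrite ltxx.
by rewrite (le_trans (ltW c_gt0)).
Qed.

(** * The recursion for the transition matrix and its limit *)

Lemma inner_widen (R : realType) (M : infmx R) (p q : {poly R[i]}) (N : nat) :
  (size p <= N)%N -> (size q <= N)%N ->
  inner M p q = \sum_(i < N) \sum_(j < N) p`_i * Num.conj q`_j * M i j.
Proof.
move=> le_pN le_qN; rewrite /inner.
rewrite (big_ord_widen N (fun i => \sum_(j < size q)
  p`_i * Num.conj q`_j * M i j) le_pN) big_mkcond; apply: eq_bigr => i _.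
have [_|le_pi] := ltnP; last first.
  by rewrite big1 // => j _; rewrite (nth_default _ le_pi) !mul0r.
rewrite (big_ord_widen N (fun j => p`_i * Num.conj q`_j * M i j) le_qN).
rewrite big_mkcond; apply: eq_bigr => j _; have [//|le_qj] := ltnP.
by rewrite (nth_default _ le_qj) rmorph0 mulr0 mul0r.
Qed.

Lemma transition_matrix_upper (R : realType) (M B : infmx R) :
  transition_matrix M B -> forall k n, (n < k)%N -> B k n = 0.
Proof. by case=> P [sP _ _] BP k n lt_nk; rewrite BP nth_default ?sP. Qed.

Lemma transition_matrix_diag_gt0 (R : realType) (M B : infmx R) :
  transition_matrix M B -> forall n, 0 < B n n.
Proof. by case=> P [_ P_gt0 _] BP n; rewrite BP. Qed.

Lemma toeplitz_transition_recursion (R : realType) (T B : infmx R) :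
  HPD T -> toeplitz T -> transition_matrix T B ->
  forall N i j, (i <= N)%N -> (j <= N)%N ->
    \sum_(k < N.+1) Num.conj (B i k) * B j k =
    (if (i == 0)%N || (j == 0)%N then 0
     else \sum_(k < N) Num.conj (B i.-1 k) * B j.-1 k)
    + B (N - i)%N N * Num.conj (B (N - j)%N N).
Proof.
move=> [Therm _] [t Tt] hB; apply: (@kernel_recursion _ t).
- have herm (m : nat) : t (- m%:Z) = Num.conj (t m%:Z).
    by have := Therm m 0; rewrite !Tt sub0r subr0.
  by case=> m; rewrite ?NegzE ?opprK herm ?conjCK.
- exact: transition_matrix_upper hB.
- exact: transition_matrix_diag_gt0 hB.
- case: hB => P [sP _ oP] BP N m n le_mN le_nN; rewrite -oP.
  rewrite (@inner_widen _ _ _ _ N.+1) ?sP //.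
  by apply: eq_bigr => i _; apply: eq_bigr => j _; rewrite !BP Tt.
Qed.

(** The entries of A - Z A Z^t with Z the down-shift matrix, known as the
    displacement of A; A is Toeplitz exactly when it vanishes off the border. *)
Definition toeplitz_defect (R : realType) (A : infmx R) (i j : nat) : R[i] :=
  A i j - (if (i == 0)%N || (j == 0)%N then 0 else A i.-1 j.-1).

Lemma cvg_toeplitz_defect (R : realType) (T B A : infmx R) :
  HPD T -> toeplitz T -> transition_matrix T B ->
  formal_product (conj_infmx B) (tr_infmx B) A ->
  forall i j, (B (n - i)%N n * Num.conj (B (n - j)%N n) : R[i]^o)
    @[n --> \oo] --> (toeplitz_defect A i j : R[i]^o).
Proof.
move=> hT toepT hB hA i j.
pose S i j n : R[i]^o := series (fun k => conj_infmx B i k * tr_infmx B k j) n.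
have SE a b n : S a b n = \sum_(k < n) Num.conj (B a k) * B b k.
  by rewrite /S /series /= big_mkord.
pose S' n : R[i]^o := if (i == 0)%N || (j == 0)%N then 0 else S i.-1 j.-1 n.
have cvgS' : S' n @[n --> \oo] -->
    (if (i == 0)%N || (j == 0)%N then 0 else A i.-1 j.-1 : R[i]^o).
  by rewrite /S'; case: ifP => _; [exact: cvg_cst|exact: hA].
have cvgS : S i j n.+1 @[n --> \oo] --> A i j.
  by have := hA i j; rewrite -cvg_shiftS.
have cvgD : (S i j n.+1 - S' n) @[n --> \oo] -->
    (toeplitz_defect A i j : R[i]^o).
  exact: (cvgB cvgS cvgS').
apply: cvg_trans cvgD; apply: near_eq_cvg.
exists (maxn i j) => // n /=; rewrite geq_max => /andP[le_in le_jn].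
have := toeplitz_transition_recursion hT toepT hB le_in le_jn.
by rewrite /S' !SE => ->; case: ifP => _; rewrite addrAC subrr add0r.
Qed.

(** The case i = j = 0 of the recursion: b_{n,n}^2 is the n-th partial sum of the
    series of |b_{0,k}|^2, so it converges and is at least b_{0,0}^2. *)
Lemma transition_diag_cvg (R : realType) (T B A : infmx R) :
  HPD T -> toeplitz T -> transition_matrix T B ->
  formal_product (conj_infmx B) (tr_infmx B) A ->
  exists2 r : R[i]^o, r != 0 & B n n @[n --> \oo] --> r.
Proof.
move=> hT toepT hB hA; have B_gt0 := transition_matrix_diag_gt0 hB.
have Breal n : Num.conj (B n n) = B n n by apply/CrealP/ger0_real/ltW.
apply: (@cvg_sqrt_pos _ _ (B 0 0)%N (toeplitz_defect A 0 0)) => //.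
- move=> n; rewrite -ler_sqr; [|exact: ltW|exact: ltW].
  have := toeplitz_transition_recursion hT toepT hB (leq0n n) (leq0n n).
  rewrite /= add0r subn0 Breal -!expr2 => <-.
  rewrite big_ord_recl /= Breal -expr2 lerDl sumr_ge0 // => k _.
  by rewrite mulrC mul_conjC_ge0.
- have := @cvg_toeplitz_defect _ _ _ _ hT toepT hB hA 0%N 0%N.
  by under eq_fun do rewrite subn0 Breal -expr2.
Qed.

(** * Asymptotically Toeplitz matrices *)

(** Below the main diagonal the entries vanish, so only the limits along the
    superdiagonals matter. *)
Lemma weakly_asymptotic_toeplitz_upper (R : realType) (B : infmx R)
    (beta : nat -> R[i]^o) :
  (forall k n, (n < k)%N -> B k n = 0) ->
  (forall k, B (n - k)%N n @[n --> \oo] --> beta k) ->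
  weakly_asymptotic_toeplitz B.
Proof.
move=> Bup Bbeta [m|m]; apply/cvg_ex.
  exists (beta m); have := Bbeta m; rewrite -(cvg_shiftn m) /=.
  apply: cvg_trans; apply: near_eq_cvg; apply: nearW => n /=.
  by rewrite addnK.
exists 0; apply: (@cvg_near_cst _ _ (0 : R[i]^o)).
by exists m.+1 => // n /= lt_mn; rewrite Bup //; lia.
Qed.

Lemma formal_product_conj_tr_herm (R : realType) (B A : infmx R) :
  formal_product (conj_infmx B) (tr_infmx B) A ->
  forall i j, A i j = Num.conj (A j i).
Proof.
move=> hA i j; apply: cvg_unique (hA i j) _ => //.
have := cvg_conj (hA j i); apply: cvg_trans; apply: near_eq_cvg.
apply: nearW => n; rewrite /series /= rmorph_sum; apply: eq_bigr => k _.
by rewrite rmorphM /= /conj_infmx /tr_infmx conjCK mulrC.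
Qed.

Lemma mul_le_sqrD (F : numDomainType) (x y : F) :
  0 <= x -> 0 <= y -> x * y <= x ^+ 2 + y ^+ 2.
Proof.
move=> x_ge0 y_ge0; rewrite -subr_ge0.
have -> : x ^+ 2 + y ^+ 2 - x * y = (x - y) ^+ 2 + x * y by ring.
apply: addr_ge0; last exact: mulr_ge0.
by rewrite real_exprn_even_ge0 // rpredB // ger0_real.
Qed.

(** The majorant is |beta_i|^2 + |beta_{i+j}|^2, taken as a real sequence so that
    [cvg_series_dominated] applies. *)
Lemma square_summable_shift_abs (R : realType) (beta : nat -> R[i]^o) (j : nat) :
  cvgn (series (fun k => (`|beta k| ^+ 2 : R[i]^o))) ->
  exists2 v : nat -> R, cvgn (series v) &
    forall i, `|beta i * Num.conj (beta (i + j)%N)| <= ((v i)%:C : R[i]).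
Proof.
move=> /cvg_ex[/= l /cvg_Re cv].
pose w i := complex.Re (`|beta i| ^+ 2).
have wE i : (w i)%:C = `|beta i| ^+ 2.
  by apply: RRe_real; rewrite realX.
have cw : cvgn (series w).
  apply/cvg_ex; exists (complex.Re l); apply: cvg_trans cv; apply: near_eq_cvg.
  by apply: nearW => n; rewrite /series /= raddf_sum.
have cwj : cvgn (series (fun i => w (i + j)%N)).
  have := cw; rewrite -(is_cvg_series_restrict j) => /cvg_ex[/= m].
  rewrite -(cvg_shiftn j) /= => cm; apply/cvg_ex; exists m.
  apply: cvg_trans cm; apply: near_eq_cvg; apply: nearW => n /=.
  by rewrite /series /= -{1}[j]add0n big_addn addnK.
exists (w + (fun i => w (i + j)%N)); first exact: is_cvg_seriesD.
move=> i; rewrite fctE (rmorphD (real_complex R)) /= !wE normrM norm_conjC.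
exact: mul_le_sqrD.
Qed.

Theorem theorem1 (R : realType) (T B A : infmx R)
    (hT : HPD T) (toepT : toeplitz T) (hB : transition_matrix T B)
    (hA : formal_product (conj_infmx B) (tr_infmx B) A) :
  exists beta : nat -> R[i]^o,
    [/\ weakly_asymptotic_toeplitz B /\
        (forall k : nat, B (n - k)%N n @[n --> \oo] --> beta k),
        (forall i k : nat, (i <= k)%N ->
          A i k = \sum_(0 <= j < i.+1) beta j * Num.conj (beta (k - i + j)%N))
      & cvgn (series (fun k : nat => (`|beta k| ^+ 2 : R[i]^o))) ->
        weakly_asymptotic_toeplitz A /\
        (forall j : nat,
          cvgn (series (fun i : nat =>
            (`|beta i * Num.conj (beta (i + j)%N)| : R[i]^o))) /\
          (A k (k + j)%N @[k --> \oo] -->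
            limn (series (fun i : nat =>
              (beta i * Num.conj (beta (i + j)%N) : R[i]^o)))))].
Proof.
have [r r_neq0 Br] := transition_diag_cvg hT toepT hB hA.
have Bdefect := @cvg_toeplitz_defect _ _ _ _ hT toepT hB hA.
have B_gt0 := transition_matrix_diag_gt0 hB.
pose beta k : R[i]^o := toeplitz_defect A k 0 / r.
have Bbeta k : B (n - k)%N n @[n --> \oo] --> beta k.
  apply: cvg_trans (cvgM (Bdefect k 0%N) (cvgV r_neq0 Br)).
  apply: near_eq_cvg; apply: nearW => n; rewrite /= subn0.
  have -> : Num.conj (B n n) = B n n by apply/CrealP/ger0_real/ltW.
  by rewrite mulfK // gt_eqF.
have defectE i j : toeplitz_defect A i j = beta i * Num.conj (beta j).
  exact: cvg_unique (Bdefect i j) (cvgM (Bbeta i) (cvg_conj (Bbeta j))).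
have AE i k : (i <= k)%N ->
    A i k = \sum_(0 <= j < i.+1) beta j * Num.conj (beta (k - i + j)%N).
  elim: i k => [|i IH] k le_ik.
    by rewrite big_nat1 subn0 addn0 -defectE /toeplitz_defect subr0.
  case: k le_ik => // k le_ik; rewrite big_nat_recr //= subSS -IH //.
  by rewrite addnS subnK // -defectE /toeplitz_defect /= addrC subrK.
exists beta; split; [split; last exact: Bbeta|exact: AE|].
  exact: weakly_asymptotic_toeplitz_upper (transition_matrix_upper hB) Bbeta.
move=> beta_l2.
have Acvg j : A k (k + j)%N @[k --> \oo] -->
    limn (series (fun i => (beta i * Num.conj (beta (i + j)%N) : R[i]^o))).
  have [v cv le_v] := square_summable_shift_abs j beta_l2.
  have := cvg_series_dominated le_v cv; rewrite -cvg_shiftS.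
  apply: cvg_trans; apply: near_eq_cvg; apply: nearW => k /=.
  rewrite AE ?leq_addr // addKn; apply: eq_bigr => i _.
  by rewrite addnC.
split=> [[m|m]|j].
- by apply/cvg_ex; eexists; exact: Acvg m.
(* Subdiagonals: A is Hermitian, so they are conjugate to superdiagonals. *)
- apply/cvg_ex; eexists; rewrite -(cvg_shiftn m.+1).
  apply: cvg_trans (cvg_conj (Acvg m.+1)); apply: near_eq_cvg.
  apply: nearW => n /=; rewrite -(formal_product_conj_tr_herm hA).
  by congr (A _ _); lia.
- split; last exact: Acvg.
  have [v cv le_v] := square_summable_shift_abs j beta_l2.
  by apply: (cvg_series_dominated _ cv) => i; rewrite normr_id.
Qed.
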